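(* Let $k\in\mathbb{N}$ and $r\in[k]$. The number of $k$-permutation matrices that have an $r$-repetition is at most $2k^2\cdot k!/r!$. Consequently, the number of $k$-permutation matrices that are not scattered is $o(k!)$ as $k\to\infty$.
   Context: A $k$-permutation matrix is a $k\times k$ binary matrix with exactly one $1$-entry in every row and every column. A $1$-entry is identified with its position $(i,j)$; the distance vector from $(i_1,j_1)$ to $(i_2,j_2)$ is $(i_2-i_1,j_2-j_1)$. A vector is $r$-repeated in a permutation matrix $P$ if it occurs as the distance vector of at least $r$ pairs of $1$-entries of $P$; $P$ has an $r$-repetition if some vector is $r$-repeated in $P$, and is $r$-repetition-free otherwise. A $k$-permutation matrix is scattered if it is $r$-repetition-free for every $r\ge 4\log_2 k/\log_2\log_2 k$. *)

(* Defs.v *)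
From HB Require Import structures.
From mathcomp Require Import all_boot all_order all_algebra.
From mathcomp Require Import all_classical all_reals all_analysis.

Set Implicit Arguments.
Unset Strict Implicit.
Unset Printing Implicit Defensive.

Import Order.TTheory GRing.Theory Num.Theory.
Import numFieldNormedType.Exports.

Local Open Scope ring_scope.

Section PermutationMatrices.
Variable k : nat.
Implicit Types (P : 'M[bool]_k) (p q : 'I_k * 'I_k) (v : int * int) (r : nat).

Definition permutation_matrix P : bool :=
  [forall i, #|[set j | P i j]| == 1%N] && [forall j, #|[set i | P i j]| == 1%N].

Definition one_entries P : {set 'I_k * 'I_k} := [set p | P p.1 p.2].

Definition distance_vector p q : int * int :=
  ((q.1 : nat)%:Z - (p.1 : nat)%:Z, (q.2 : nat)%:Z - (p.2 : nat)%:Z).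

(* The pairs consist of two distinct 1-entries: otherwise (0, 0) would be
   k-repeated in every k-permutation matrix. Since v is then nonzero, counting
   ordered pairs is the same as counting unordered ones. *)
Definition repeated r v P : bool :=
  (r <= #|[set pq : ('I_k * 'I_k) * ('I_k * 'I_k) |
           [&& pq.1 \in one_entries P, pq.2 \in one_entries P, pq.1 != pq.2
             & distance_vector pq.1 pq.2 == v]]|)%N.

Definition has_repetition r P : Prop := exists v, repeated r v P.

Definition repetition_free r P : Prop := ~ has_repetition r P.

End PermutationMatrices.

Definition log2 (R : realType) (x : R) : R := ln x / ln 2.

(* For k <= 2 the threshold is a junk value, log2 (log2 k) being 0 or the
   logarithm of 0. *)
Definition scattered (R : realType) (k : nat) (P : 'M[bool]_k) : Prop :=
  forall r : nat,
    4 * log2 (k%:R : R) / log2 (log2 (k%:R : R)) <= r%:R -> repetition_free r P.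

Definition num_with_repetition (k r : nat) : nat :=
  #|[set P : 'M[bool]_k | permutation_matrix P && `[< has_repetition r P >]]|.

Definition num_not_scattered (R : realType) (k : nat) : nat :=
  #|[set P : 'M[bool]_k | permutation_matrix P && `[< ~ scattered R P >]]|.

(* Main.v *)
(* Fix a vector v pointing to the right, and let S be a set of r rows whose
   1-entries are sources of occurrences of v. The matrix is determined by the
   list of the k - r remaining rows ordered by the column of their 1-entry:
   reading columns from right to left, the target of an occurrence is always
   known before its source. There are k!/r! such lists, and up to sign there are
   at most 2k^2 vectors. For the asymptotic part, r! >= (r/e)^r >= k^3 as soon
   as r is at least the threshold and k is large. *)

Require Import Defs.
From HB Require Import structures.
From mathcomp Require Import all_boot all_order all_algebra all_fingroup.
From mathcomp Require Import all_classical all_reals all_analysis.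
From mathcomp Require Import zify lra ring.

Import Order.TTheory GRing.Theory Num.Theory.
Import numFieldNormedType.Exports.

Local Open Scope ring_scope.

(** * Permutations with many occurrences of a fixed vector *)

Lemma permutation_matrix_perm (k : nat) (P : 'M[bool]_k) :
  permutation_matrix P -> exists s : 'S_k, P = \matrix_(i, j) (s j == i).
Proof.
case/andP=> /forallP rowP /forallP colP.
have colE j : exists i0, forall i, P i j = (i0 == i).
  have /cards1P[i0 /setP Ei0] := colP j; exists i0 => i.
  by have := Ei0 i; rewrite !inE eq_sym.
have [f fE] := choice colE.
have f_inj : injective f.
  move=> j j' fjj'; have /cards1P[j0 /setP Ej0] := rowP (f j).
  have := Ej0 j; have := Ej0 j'; rewrite !inE !fE fjj' eqxx.
  by move=> /esym/eqP-> /esym/eqP.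
by exists (perm f_inj); apply/matrixP => i j; rewrite mxE permE fE.
Qed.

(** Here [s] sends a column to the row of its 1-entry, so sources are recorded by row, and [codom s]
    lists the rows by column from left to right. *)
Definition sources (k : nat) (v : int * int) (s : 'S_k) : {set 'I_k} :=
  [set s p.1 | p : 'I_k * 'I_k
     & distance_vector (s p.1, p.1) (s p.2, p.2) == v].

(* The columns are compared from right to left: a source is located by its
   target, which lies further right, and a non-source by its rank in the list. *)
Lemma perm_eq_of_nonsources (k : nat) (v : int * int) (S : {set 'I_k})
    (s s' : 'S_k) :
  0 < v.2 -> S \subset sources k v s -> S \subset sources k v s' ->
  [seq x <- codom s | x \notin S] = [seq x <- codom s' | x \notin S] -> s = s'.
Proof.
move=> v2_gt0 Ss Ss' eq_code.
suff agree m : (m <= k)%N -> forall j : 'I_k, (k - m <= j)%N -> s j = s' j.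
  by apply/permP => j; apply: (agree k) => //; rewrite subnn.
elim: m => [_ j|m IHm m_lt_k j]; first by rewrite subn0 leqNgt ltn_ord.
have {}IHm := IHm (ltnW m_lt_k).
rewrite leq_eqVlt => /orP[/eqP jE|]; last first.
  by move=> lt_mj; apply: IHm; move: lt_mj; lia.
(* The target of row [t j] under [t] lies in a column [b > j], where [t] and [t'] agree. Under [t']
   the target of that row has the same row, hence the same column [b], and stepping back by [v.2]
   returns to [j]. *)
have right_of (t t' : 'S_k) : (forall i : 'I_k, (k - m <= i)%N -> t i = t' i) ->
    S \subset sources k v t -> S \subset sources k v t' -> t j \in S -> t j = t' j.
  move=> tt' St St' tjS.
  have /imsetP[[a b] /= ] := fintype.subsetP St _ tjS; rewrite inE => /eqP vE /perm_inj ja.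
  have /imsetP[[c d] /= ] := fintype.subsetP St' _ tjS.
  rewrite inE => /eqP vE' ac.
  move: vE vE'; rewrite /distance_vector /= ac -ja.
  case: v v2_gt0 {Ss Ss' St St'} => v1 v2 /= v2_gt0 [ab1 ab2] [cd1 cd2].
  have eq_t : t b = t' d by apply: val_inj => /=; move: ab1 cd1; rewrite ac; lia.
  have db : d = b by apply: (@perm_inj _ t'); rewrite -eq_t tt' //; lia.
  by congr (t' _); apply: val_inj => /=; move: cd2; rewrite db; lia.
case sjS: (s j \in S); first exact: right_of.
case s'jS: (s' j \in S).
  by apply/esym/right_of => // i /IHm.
have codom_enum (t : 'S_k) : codom t = map t (enum 'I_k) by [].
have cut (t : 'S_k) : codom t = take j (codom t) ++ t j :: drop j.+1 (codom t).
  rewrite -{1}(cat_take_drop j (codom t)) (drop_nth (t j)); last first.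
    by rewrite size_codom card_ord.
  congr (_ ++ _ :: _); rewrite codom_enum (nth_map j) ?nth_ord_enum//.
  by rewrite size_enum_ord.
have eq_drop : drop j.+1 (codom s) = drop j.+1 (codom s').
  rewrite !codom_enum -[LHS]map_drop -[RHS]map_drop; apply/eq_in_map => i.
  move=> /(nthP j)[n]; rewrite size_drop size_enum_ord nth_drop => ltn <-.
  have nk : (j.+1 + n < k)%N by lia.
  by apply: IHm; rewrite nth_enum_ord//; lia.
move: eq_code; rewrite (cut s) (cut s') !filter_cat /= sjS s'jS /= eq_drop => eqC.
(* Equal tails force filtered heads of equal length, so [s j] and [s' j] stand at the same place of
   the common list. *)
have := congr1 size eqC; rewrite !size_cat /= => /addIn eq_size.
by move/eqP: eqC; rewrite eqseq_cat// => /andP[_ /eqP[]].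
Qed.

Lemma card_many_sources (k r : nat) (v : int * int) : 0 < v.2 ->
  (#|[set s : 'S_k | r <= #|sources k v s|]%N| * r`! <= k`!)%N.
Proof.
move=> v2_gt0; set D := [set s | _].
have [le_rk|lt_kr] := leqP r k; last first.
  suff -> : D = finset.set0 by rewrite cards0.
  apply/setP => s; rewrite !inE leqNgt; apply/negbTE; rewrite negbK.
  by rewrite (leq_ltn_trans _ lt_kr)// -[leqRHS]card_ord max_card.
(* Choosing exactly [r] sources gives every code the length [k - r]. *)
pose S (s : 'S_k) := [set x in take r (enum (sources k v s))].
have S_sub s : S s \subset sources k v s.
  by apply/fintype.subsetP => x; rewrite inE => /mem_take; rewrite mem_enum.
have cardS s : s \in D -> #|S s| = r.
  rewrite inE => le_r; rewrite cardsE (card_uniqP _) ?take_uniq ?enum_uniq//.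
  by rewrite size_takel// -cardE.
pose code (s : 'S_k) := [seq x <- codom s | x \notin S s].
have memS s x : (x \in code s) = (x \notin S s).
  by rewrite mem_filter perm_onto andbT.
have uniq_code s : uniq (code s).
  by rewrite filter_uniq // map_inj_uniq ?enum_uniq //; exact: perm_inj.
have size_code s : s \in D -> size (code s) = (k - r)%N.
  move=> /cardS <-; rewrite -(card_uniqP (uniq_code s)) -[X in (X - _)%N]card_ord.
  by rewrite -(cardsC (S s)) addKn; apply: eq_card => x; rewrite finset.inE -memS.
pose f s := insub (code s) : option ((k - r).-tuple 'I_k).
have f_inj : {in D &, injective f}.
  move=> s s' sD s'D; rewrite /f !insubT ?size_code// => _ _ [eq_code].
  (* The chosen set varies with [s], but the code reveals it as the set of missing rows. *)
  have eqS : S s' = S s.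
    by apply/setP => x; apply: negb_inj; rewrite -!memS eq_code.
  apply: (@perm_eq_of_nonsources _ v (S s)) => //; first by rewrite -eqS.
  by rewrite /code eqS in eq_code.
(* Codes are lists of [k - r] distinct rows, and there are [k ^_ (k - r)], that is k!/r!, of
   them. *)
rewrite -(card_in_imset f_inj) -(ffact_fact (leq_subr r k)) subKn//.
rewrite leq_mul2r; apply/orP; right.
have := card_uniq_tuples (k - r) (predT : pred 'I_k); rewrite card_ord => <-.
rewrite -[leqRHS](card_imset _ Some_inj).
apply/subset_leq_card/fintype.subsetP => _ /imsetP[s sD ->].
rewrite /f insubT ?size_code// => sz; apply: imset_f.
by rewrite inE /= uniq_code andbT; apply/allP.
Qed.

(** * Summing over the vectors *)

(** An occurrence is determined by the row of its source: [s] gives the column, and [v.2] the column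
    of the target. *)
Lemma repeated_sources (k r : nat) (v : int * int) (s : 'S_k) : 0 < v.2 ->
  repeated r v (\matrix_(i, j) (s j == i)) -> (r <= #|sources k v s|)%N.
Proof.
move=> v2_gt0 /leq_trans; apply.
rewrite card_in_imset => [|[a b] [c d]]; last first.
  rewrite !inE /= => /eqP vE /eqP vE' /perm_inj ac; move: vE vE'; rewrite -ac.
  case: v {v2_gt0} => v1 v2 [_ ab] [_ cd]; congr pair.
  by apply: val_inj => /=; move: cd; rewrite -ab; lia.
pose entries (p : 'I_k * 'I_k) := ((s p.1, p.1), (s p.2, p.2)).
apply: leq_trans (leq_imset_card entries _).
apply/subset_leq_card/fintype.subsetP => -[[i j] [i' j']].
rewrite !inE /= !mxE => /and4P[/eqP <- /eqP <- _ vE].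
by apply/imsetP; exists (j, j'); rewrite ?inE.
Qed.

Lemma repeated_opp (k r : nat) (v : int * int) (P : 'M[bool]_k) :
  repeated r v P -> repeated r (- v.1, - v.2) P.
Proof.
move=> /leq_trans; apply.
apply: leq_trans (leq_imset_card (fun pq => (pq.2, pq.1)) _).
apply/subset_leq_card/fintype.subsetP => -[p q].
rewrite !inE /= => /and4P[Pp Pq neq_pq /eqP <-].
apply/imsetP; exists (q, p) => //; rewrite !inE /= Pp Pq eq_sym neq_pq /=.
by rewrite /distance_vector /= !opprB.
Qed.

(** A single occurrence suffices; [v.2] is nonzero because distinct 1-entries lie in distinct
    columns. *)
Lemma repeated_bounds (k r : nat) (v : int * int) (s : 'S_k) : (0 < r)%N ->
  repeated r v (\matrix_(i, j) (s j == i)) ->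
  [/\ `|v.1|%N < k, `|v.2|%N < k & v.2 != 0]%N.
Proof.
move=> r_gt0 /(leq_trans r_gt0)/card_gt0P[[[i j] [i' j']]].
rewrite !inE /= !mxE => /and4P[/eqP <- /eqP <- neq /eqP <-] /=.
have [[[sj sj'] jk] j'k] := (ltn_ord (s j), ltn_ord (s j'), ltn_ord j, ltn_ord j').
split; [lia|lia|]; apply: contraNneq neq => /eqP.
by rewrite subr_eq0 => /eqP[/val_inj->].
Qed.

Lemma card_bigsetU_le (I T : finType) (F : I -> {set T}) :
  (#|\big[@finset.setU T/finset.set0]_i F i| <= \sum_i #|F i|)%N.
Proof.
elim/big_rec2: _ => [|i n A _ le_An]; first by rewrite cards0.
by rewrite (leq_trans (leq_card_setU _ _))// leq_add2l.
Qed.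

Lemma num_with_repetition_le (k r : nat) : (0 < r)%N ->
  (num_with_repetition k r * r`! <= 2 * k ^ 2 * k`!)%N.
Proof.
move=> r_gt0.
(* The shift by [k] lets the first coordinate range over -k, ..., k - 1. The index set has the 2k^2
   elements of the bound. *)
pose vec (ab : 'I_(2 * k) * 'I_k) : int * int :=
  ((ab.1 : nat)%:Z - k%:Z, (ab.2 : nat)%:Z).
pose F ab := if 0 < (vec ab).2
  then [set s : 'S_k | r <= #|sources k (vec ab) s|]%N else finset.set0.
pose M (s : 'S_k) := \matrix_(i, j) (s j == i).
have le_num : (num_with_repetition k r <= \sum_ab #|F ab|)%N.
  apply: leq_trans (card_bigsetU_le _ _ F).
  apply: leq_trans (leq_imset_card M _).
  apply/subset_leq_card/fintype.subsetP => P; rewrite inE.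
  move=> /andP[/permutation_matrix_perm[s ->] /asboolP[v rep_v]].
  apply: imset_f.
  have [w rep_w w2_gt0] : exists2 w, repeated r w (M s) & 0 < w.2.
    have [_ _ v2_neq0] := repeated_bounds _ _ _ _ r_gt0 rep_v.
    have [v2_gt0|] := ltrP 0 v.2; first by exists v.
    rewrite le_eqVlt (negbTE v2_neq0) => v2_lt0.
    by exists (- v.1, - v.2); [exact: repeated_opp|rewrite oppr_gt0].
  have [w1 w2 _] := repeated_bounds _ _ _ _ r_gt0 rep_w.
  have abs1 : (`|(w.1 + k%:Z)%R|%N < 2 * k)%N by lia.
  pose ab := (Ordinal abs1, Ordinal w2).
  have wE : vec ab = w.
    by rewrite /vec /= [RHS]surjective_pairing; congr pair; lia.
  rewrite (bigD1 ab) //= finset.inE /F wE w2_gt0 finset.inE.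
  by rewrite repeated_sources.
apply: leq_trans (leq_mul le_num (leqnn _)) _; rewrite big_distrl /=.
have -> : (2 * k ^ 2 * k`! = \sum_(ab : 'I_(2 * k) * 'I_k) k`!)%N.
  by rewrite sum_nat_const card_prod !card_ord; lia.
apply: leq_sum => ab _; rewrite /F; case: ifP => [|_]; last by rewrite cards0.
exact: card_many_sources.
Qed.

(** * Asymptotics *)

(** This is (r/e)^r <= r!, obtained from the single term r^r/r! of the series of e^r. *)
Lemma expR_le_fact (R : realType) (r : nat) : (0 < r)%N ->
  expR (r%:R * (ln r%:R - 1)) <= r`!%:R :> R.
Proof.
case: r => // r _.
have r_gt0 : 0 < r.+1%:R :> R by rewrite ltr0n.
have f_gt0 : 0 < r.+1`!%:R :> R by rewrite ltr0n fact_gt0.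
rewrite mulrBr mulr1 expRD expRM_natl lnK ?posrE// expRN.
rewrite ler_pdivrMr ?expR_gt0// -ler_pdivrMl// mulrC.
by apply: le_trans (expR_ge1Dxn r (ltW r_gt0)); rewrite lerDr.
Qed.

(* With y = ln (log2 k), the threshold is X = 4 log2 k ln 2 / y and
   ln X - 1 >= 3 y / 4 once y is large, so (X / e) ^ X >= k ^ 3. *)
Lemma cube_le_fact_threshold (R : realType) : \forall k \near \oo%classic,
  forall r : nat, 4 * log2 (k%:R : R) / log2 (log2 (k%:R : R)) <= r%:R ->
    k%:R ^+ 3 <= r`!%:R :> R.
Proof.
have ln2_gt0 : 0 < ln 2 :> R by rewrite ln_gt0// ltr1n.
(* The tangent to [ln] at 8 will give ln X - 1 >= 7y/8 - C, which is at least 3y/4 once y >= 8C; the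
   summand 1 in [Y] keeps y positive. *)
pose C : R := ln 8 - ln (4 * ln 2).
pose Y := 1 + 8 * `|C|.
near=> k; move=> r; rewrite /log2.
have k_large : expR (ln 2 * expR Y) <= k%:R by near: k; exact: nbhs_infty_ger.
have k_gt0 : 0 < k%:R :> R by apply: lt_le_trans k_large; exact: expR_gt0.
have L_ge : expR Y <= ln k%:R / ln 2.
  by rewrite ler_pdivlMr// mulrC -ler_expR lnK.
set L := ln k%:R / ln 2 in L_ge *.
have L_gt0 : 0 < L by apply: lt_le_trans L_ge; exact: expR_gt0.
have y_ge : Y <= ln L by rewrite -ler_expR lnK.
set y := ln L in y_ge *.
have [C_le y_ge1] : 8 * C <= y /\ 1 <= y.
  have := ler_norm C; have := normr_ge0 C; move: y_ge; rewrite /Y; split; lra.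
have y_gt0 : 0 < y by lra.
have -> : 4 * L / (y / ln 2) = 4 * ln 2 * L / y.
  by field; rewrite !gt_eqF.
set X := _ / y => X_le_r.
have c_gt0 : 0 < 4 * ln 2 :> R by lra.
have cL_gt0 := mulr_gt0 c_gt0 L_gt0.
have X_gt0 : 0 < X by exact: divr_gt0.
have r_gt0 : 0 < r%:R :> R by apply: lt_le_trans X_le_r.
have lnX : ln X = ln (4 * ln 2) + y - ln y.
  by rewrite ln_div ?posrE// lnM ?posrE.
have lny : ln y <= ln 8 + (y / 8 - 1).
  have -> : ln y = ln 8 + ln (y / 8).
    by rewrite ln_div ?posrE// addrC subrK.
  rewrite lerD2l -[leLHS](_ : ln (1 + (y / 8 - 1)) = _); last by rewrite addrC subrK.
  by apply: le_ln1Dx; rewrite ltrBrDl subrr divr_gt0.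
have ln_r : 3 / 4 * y <= ln r%:R - 1.
  have : ln X <= ln r%:R by rewrite ler_ln ?posrE.
  move: lny C_le; rewrite lnX /C; lra.
apply: le_trans (expR_le_fact _ _ _); last by rewrite -(ltr0n R).
rewrite -[k%:R]lnK ?posrE// -expRM_natl ler_expR.
(* The 4 of the threshold times 3/4 yields the exponent 3. *)
have -> : 3 * ln k%:R = X * (3 / 4 * y).
  by rewrite /X /L; field; rewrite !gt_eqF.
by apply: ler_pM => //; [exact: ltW|lra].
Unshelve. all: by end_near. Qed.

(** The least natural number [r] above the threshold works: a vector repeated [n >= r] times is also
    [r]-repeated. *)
Lemma num_not_scattered_le (R : realType) (k : nat) : exists2 r : nat,
  4 * log2 (k%:R : R) / log2 (log2 (k%:R : R)) <= r%:R
  & (num_not_scattered R k <= num_with_repetition k r)%N.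
Proof.
set X := 4 * _ / _.
have X_le : exists n : nat, X <= n%:R.
  exists (Num.bound `|X|); apply: le_trans (ler_norm X) _.
  exact/ltW/archi_boundP.
case: (ex_minnP X_le) => r X_le_r r_min; exists r => //.
apply/subset_leq_card/fintype.subsetP => P; rewrite !finset.inE => /andP[-> /=].
move=> /asboolP not_scattered; apply/asboolP; apply: contrapT => no_rep.
apply: not_scattered => n X_le_n [v rep_v]; apply: no_rep; exists v.
exact: leq_trans (r_min _ X_le_n) rep_v.
Qed.

Local Open Scope classical_set_scope.

Theorem theorem2p2 (R : realType) :
  (forall k r : nat, (1 <= r <= k)%N ->
     (num_with_repetition k r)%:R
       <= 2 * k%:R ^+ 2 * k`!%:R / r`!%:R :> R) /\
  (fun k : nat => (num_not_scattered R k)%:R : R)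
    =o_\oo (fun k : nat => k`!%:R : R).
Proof.
have bound (k r : nat) : (0 < r)%N -> (num_with_repetition k r)%:R
    <= 2 * k%:R ^+ 2 * k`!%:R / r`!%:R :> R.
  move=> /num_with_repetition_le le_num.
  rewrite ler_pdivlMr ?ltr0n ?fact_gt0//.
  by move: (le_num k); rewrite -(ler_nat R) !natrM expr2.
split=> [k r /andP[r_gt0 _]|]; first exact: bound.
apply/eqoP => eps eps_gt0; near=> k.
have [r thr_le le_num] := num_not_scattered_le R k.
have cube_le : k%:R ^+ 3 <= r`!%:R :> R.
  by move: r thr_le {le_num}; near: k; exact: cube_le_fact_threshold.
have k_ge2 : 2 <= k%:R :> R by near: k; exact: nbhs_infty_ger.
(* As r! >= k^3, the bound 2k^2 k!/r! is at most (2/k) k!. *)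
have k_ge_eps : 2 / eps <= k%:R by near: k; exact: nbhs_infty_ger.
(* The value r = 0 would give k^3 <= 0! = 1. *)
have r_gt0 : (0 < r)%N.
  case: r cube_le {thr_le le_num} => //; rewrite fact0 => cube_le.
  have : 1 < k%:R ^+ 3 :> R by rewrite exprn_egt1//; lra.
  lra.
rewrite !normr_nat; apply: (@le_trans _ _ (num_with_repetition k r)%:R).
  by rewrite ler_nat.
apply: le_trans (bound _ _ r_gt0) _.
rewrite ler_pdivrMr ?ltr0n ?fact_gt0// [leRHS]mulrAC ler_pM2r ?ltr0n ?fact_gt0//.
apply: (@le_trans _ _ (eps * k%:R ^+ 3)); last by rewrite ler_pM2l.
rewrite [_ ^+ 3]exprS mulrA ler_pM2r ?exprn_gt0//; last lra.
by rewrite mulrC -ler_pdivrMr.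
Unshelve. all: by end_near. Qed.
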